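(* Let $a_1,d$ be positive integers and let $n>a_1+d$. For every integer $l>0$, the number of primitive periodic orbits of length $l$ on the directed circulant graph $C_n^+(a_1,a_1+d)$ is \[ PO(n,l,a_1,d)=\frac{n}{l}\sum_{m=\lceil a_1 l/n\rceil}^{\lfloor (d+a_1)l/n\rfloor}\ \sum_{\omega\mid m,\ \omega\mid l}\mu(\omega)\binom{l/\omega}{\frac{mn-a_1l}{\omega d}}, \] where the inner sum runs over positive integers $\omega$ dividing both $m$ and $l$.
   Context: $C_n^+(a_1,a_1+d)$ is the directed graph with vertex set $\{0,1,\dots,n-1\}$ (identified with $\mathbb{Z}/n\mathbb{Z}$) whose bonds (directed edges) are $(v, v+a_1 \bmod n)$ and $(v, v+a_1+d \bmod n)$ for every vertex $v$. A walk of length $l$ is a sequence of vertices $v_0,v_1,\dots,v_l$ with each $(v_i,v_{i+1})$ a bond; a circuit is a walk of positive length with $v_l=v_0$. A periodic orbit is an equivalence class of circuits under cyclic rotation; its length is the length of any circuit in it. A circuit (periodic orbit) is primitive if it is not a shorter circuit (periodic orbit) repeated several times. $\mu$ is the Möbius function: $\mu(1)=1$, $\mu(\omega)=0$ if $\omega$ is divisible by the square of a prime, and $\mu(\omega)=(-1)^k$ if $\omega$ is a product of $k$ distinct primes. Convention: a binomial coefficient $\binom{a}{b}$ is taken to be $0$ unless $a,b$ are integers with $0\le b\le a$ (in particular it is $0$ when the lower index is not an integer). *)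

(* Defs.v *)
From mathcomp Require Export all_boot all_order all_algebra.
Set Implicit Arguments.
Unset Strict Implicit.
Unset Printing Implicit Defensive.
Import Order.TTheory GRing.Theory Num.Theory.
Local Open Scope ring_scope.

Definition circulant_bond (n a1 d : nat) : rel 'I_n :=
  fun v w => ((w : nat) == (v + a1) %% n)%N || ((w : nat) == (v + a1 + d) %% n)%N.

Section PeriodicOrbits.
Variables (V : finType) (e : rel V).

(* The circuit v_0, ..., v_(l-1), v_l = v_0 is represented by the sequence
   v_0, ..., v_(l-1) of length l; [cycle] includes the closing step
   (v_(l-1), v_0). *)
Definition circuit (c : seq V) : bool := (0 < size c)%N && cycle e c.

Definition rotation_equiv (l : nat) : rel (l.-tuple V) :=
  fun b c => [exists i : 'I_l, rot i b == c :> seq V].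

(* The bound r <= l on the number of repetitions loses nothing, since a circuit
   has positive length; see [primitive_circuitP]. *)
Definition primitive_circuit (l : nat) (c : l.-tuple V) : bool :=
  circuit c &&
  [forall k : 'I_l, forall b : k.-tuple V, forall r : 'I_l.+1,
     circuit b ==> (tval c != flatten (nseq r (tval b)))].

Definition periodic_orbits (l : nat) : {set {set l.-tuple V}} :=
  equivalence_partition (@rotation_equiv l) [set c : l.-tuple V | circuit c].

Definition primitive_periodic_orbits (l : nat) : {set {set l.-tuple V}} :=
  [set O in periodic_orbits l | [forall c in O, primitive_circuit c]].

Lemma primitive_circuitP (l : nat) (c : l.-tuple V) :
  reflect (circuit c /\
           ~ exists (b : seq V) (r : nat),
               [/\ circuit b, (size b < l)%N & tval c = flatten (nseq r b)])
          (primitive_circuit c).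
Proof.
apply: (iffP andP) => -[cc h]; split=> //.
  case=> b [r [cb sb ce]].
  have b0 : (0 < size b)%N by case/andP: cb.
  have rl : (r < l.+1)%N.
    have : (size (flatten (nseq r b)) = l) by rewrite -ce size_tuple.
    rewrite size_flatten /shape map_nseq sumn_nseq => hl.
    by rewrite ltnS -hl leq_pmull.
  move/forallP: h => /(_ (Ordinal sb)) /forallP /(_ (in_tuple b)).
  by move/forallP => /(_ (Ordinal rl)) /=; rewrite cb -ce eqxx.
apply/forallP=> k; apply/forallP=> b; apply/forallP=> r; apply/implyP=> cb.
apply/eqP=> ce; apply: h; exists b, r; split=> //.
by rewrite size_tuple.
Qed.

Lemma rotation_equivP (l : nat) :
  {in [set c : l.-tuple V | circuit c] & &, equivalence_rel (@rotation_equiv l)}.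
Proof.
move=> x y z; rewrite inE => /andP[x0 _] _ _.
have l0 : (0 < l)%N by rewrite -(size_tuple x).
have rotE (u v : l.-tuple V) :
    reflect (exists i, rot i u = v :> seq V) (rotation_equiv u v).
  apply: (iffP existsP) => [[i /eqP h]|[i h]]; first by exists i.
  have [il|il] := ltnP i l; first by exists (Ordinal il); apply/eqP.
  exists (Ordinal l0); apply/eqP; rewrite /= rot0 -h rot_oversize //.
  by rewrite size_tuple.
have rsym (u v : l.-tuple V) : rotation_equiv u v -> rotation_equiv v u.
  case/rotE=> i h; apply/rotE; exists (size u - i)%N.
  by have := rotK i (tval u); rewrite /rotr size_rot h.
have rtrans (u v w : l.-tuple V) :
    rotation_equiv u v -> rotation_equiv v w -> rotation_equiv u w.
  case/rotE=> i hi; case/rotE=> j hj; apply/rotE.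
  have [il|il] := leqP i (size u); last first.
    by exists j; rewrite -hj -hi (rot_oversize (ltnW il)).
  have [jl|jl] := leqP j (size u); last first.
    by exists i; rewrite -hj hi rot_oversize // size_tuple -(size_tuple u) ltnW.
  rewrite -hj -hi rot_add_mod //.
  by eexists.
split; first by apply/rotE; exists 0%N; rewrite rot0.
move=> xy; apply/idP/idP; last exact: rtrans.
exact: rtrans (rsym _ _ xy).
Qed.

End PeriodicOrbits.

Definition moebius (w : nat) : int :=
  if has (fun p => p ^ 2 %| w)%N (primes w) then 0
  else (-1) ^+ size (primes w).

(* ['C(a, b)] is already 0 for natural numbers b > a. *)
Definition binomial_rat (a b : rat) : nat :=
  if (a \is a Num.nat) && (b \is a Num.nat)
  then 'C(Num.truncn a, Num.truncn b) else 0%N.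

(* Main.v *)
(** Rotation by one step acts on words of length [l], and the order of a word
    divides [l].  The primitive circuits are the circuits of order [l], hence a
    primitive orbit consists of [l] circuits, and Moebius inversion over the
    orders counts the primitive circuits from the circuits fixed by the rotation
    by [l / w].  These are the [w]-th powers of the circuits of length [l / w].
    Circuits of length [k] number the trace of the [k]-th power of the adjacency
    matrix, here a sum of the two commuting cyclic shifts by [a1] and [a1 + d]:
    by the binomial theorem the trace is [n] times the sum of the ['C(k, j)] for
    which [n] divides [a1 k + d j]; for [k = l / w] the quotient is [m / w]. *)
Require Import Defs.
From mathcomp Require Import all_boot all_order all_algebra.
From mathcomp Require Import zify.
Import Order.TTheory GRing.Theory Num.Theory.
Local Open Scope ring_scope.

Set Implicit Arguments.
Unset Strict Implicit.
Unset Printing Implicit Defensive.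

Section Divisors.
Local Open Scope nat_scope.

Lemma perm_divisors_filter_iota n : 0 < n ->
  perm_eq (divisors n) [seq d <- index_iota 1 n.+1 | d %| n].
Proof.
move=> n_gt0.
apply: uniq_perm; rewrite ?filter_uniq ?divisors_uniq ?iota_uniq //.
move=> d; rewrite mem_filter mem_index_iota -dvdn_divisors // ltnS.
have [d_dvd_n|//] := boolP (d %| n).
by rewrite (dvdn_gt0 n_gt0 d_dvd_n) (dvdn_leq n_gt0 d_dvd_n).
Qed.

Lemma perm_divisors_divn k n : 0 < n -> k %| n ->
  perm_eq (divisors (n %/ k)) [seq d <- divisors n | k * d %| n].
Proof.
move=> n_gt0 k_dvd; have quo_gt0 := dvdn_gt0 n_gt0 (dvdn_div k_dvd).
apply: uniq_perm; rewrite ?filter_uniq ?divisors_uniq // => d.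
rewrite mem_filter -!dvdn_divisors // dvdn_divRL // mulnC andb_idr //.
exact: dvdn_trans (dvdn_mull _ _).
Qed.

Lemma perm_divisors_filter_multiples k n : 0 < n -> k %| n ->
  perm_eq [seq d <- divisors n | k %| d] [seq k * d | d <- divisors (n %/ k)].
Proof.
move=> n_gt0 k_dvd; have k_gt0 := dvdn_gt0 n_gt0 k_dvd.
have quo_gt0 := dvdn_gt0 n_gt0 (dvdn_div k_dvd).
apply: uniq_perm; rewrite ?filter_uniq ?divisors_uniq //.
  rewrite map_inj_uniq ?divisors_uniq // => d d' /eqP.
  by rewrite eqn_pmul2l // => /eqP.
move=> d; rewrite mem_filter -dvdn_divisors //.
apply/andP/mapP => [[/dvdnP[u ->] u_dvd]|[u]].
  by exists u; rewrite 1?mulnC // -dvdn_divisors // dvdn_divRL.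
rewrite -dvdn_divisors // dvdn_divRL // => u_dvd ->.
by rewrite dvdn_mulr // mulnC.
Qed.

Lemma perm_divisors_filter_coprime p n : prime p -> 0 < n -> p %| n ->
  perm_eq [seq d <- divisors n | ~~ (p %| d)]
          [seq d <- divisors (n %/ p) | ~~ (p %| d)].
Proof.
move=> p_prime n_gt0 p_dvd_n; have p_gt0 := prime_gt0 p_prime.
have quo_gt0 := dvdn_gt0 n_gt0 (dvdn_div p_dvd_n).
apply: uniq_perm; rewrite ?filter_uniq ?divisors_uniq // => d.
rewrite !mem_filter -!dvdn_divisors //; have [//|pNd /=] := boolP (p %| d).
by rewrite dvdn_divRL // mulnC Gauss_dvd ?prime_coprime // p_dvd_n.
Qed.

End Divisors.

Lemma moebiusM_prime p u : prime p -> (0 < u)%N ->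
  moebius (p * u) = if (p %| u)%N then 0 else - moebius u.
Proof.
move=> p_prime u_gt0; have p_gt0 := prime_gt0 p_prime.
have [p_dvd_u|pNu] := boolP (p %| u)%N.
  rewrite /moebius ifT //; apply/hasP; exists p; last by rewrite dvdn_mul.
  by rewrite primesM // primes_prime // inE eqxx.
have p_notin : p \notin primes u by rewrite mem_primes (negPf pNu) !andbF.
have primes_pu : perm_eq (primes (p * u)) (p :: primes u).
  apply: uniq_perm; rewrite /= ?primes_uniq ?p_notin // => q.
  by rewrite primesM // primes_prime // !inE.
rewrite /moebius (perm_size primes_pu) (perm_has _ primes_pu) /= exprS mulN1r.
rewrite expnS expn1 dvdn_pmul2l // (negPf pNu) /=.
rewrite (@eq_in_has _ _ (fun q => q ^ 2 %| u)%N) => [|q q_in].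
  by case: ifP; rewrite ?oppr0.
have q_prime : prime q by move: q_in; rewrite mem_primes; case/and3P.
rewrite Gauss_dvdr // coprimeXl // prime_coprime // dvdn_prime2 //.
by apply: contraNneq p_notin => <-.
Qed.

(* For a prime [p] dividing [n], the divisors [d] and [p * d] with [d] prime to
   [p] contribute opposite terms. *)
Lemma sum_moebius_divisors n : (0 < n)%N ->
  \sum_(d <- divisors n) moebius d = (n == 1)%N%:R.
Proof.
move=> n_gt0; have [->|n_neq1] := eqVneq n 1%N; first by rewrite big_seq1.
set p := pdiv n; have p_prime : prime p by rewrite pdiv_prime //; lia.
have p_dvd_n : (p %| n)%N := pdiv_dvd n.
have quo_gt0 := dvdn_gt0 n_gt0 (dvdn_div p_dvd_n).
rewrite (bigID (fun d => p %| d)%N) /= -!(big_filter (divisors n)).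
rewrite (perm_big _ (perm_divisors_filter_multiples n_gt0 p_dvd_n)) big_map.
rewrite (perm_big _ (perm_divisors_filter_coprime p_prime n_gt0 p_dvd_n)).
rewrite big_filter [X in _ + X]big_mkcond -big_split /= big_seq big1 // => d.
rewrite -dvdn_divisors // => /(dvdn_gt0 quo_gt0) d_gt0.
by rewrite moebiusM_prime //; case: ifP; rewrite ?addr0 ?addNr.
Qed.

Lemma moebius_inversion (V : zmodType) (f g : nat -> V) n : (0 < n)%N ->
    (forall k, (k %| n)%N -> f k = \sum_(d <- divisors k) g d) ->
  g n = \sum_(d <- divisors n) f (n %/ d)%N *~ moebius d.
Proof.
move=> n_gt0 fE.
have moebius_quo k : (k %| n)%N ->
    \sum_(d <- divisors (n %/ k)) moebius d = (k == n)%:R.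
  move=> k_dvd; rewrite sum_moebius_divisors; last first.
    exact: dvdn_gt0 n_gt0 (dvdn_div k_dvd).
  by rewrite eq_sym eqn_div ?(dvdn_gt0 n_gt0) // mul1n.
transitivity (\sum_(k <- divisors n | k == n) g k).
  rewrite -big_filter filter_pred1_uniq ?divisors_uniq ?divisors_id //.
  by rewrite big_seq1.
transitivity (\sum_(k <- divisors n)
                \sum_(d <- divisors n | (k * d %| n)%N) g k *~ moebius d).
  rewrite big_mkcond; apply: eq_big_seq => k.
  rewrite -dvdn_divisors // => k_dvd.
  rewrite -big_filter -(perm_big _ (perm_divisors_divn n_gt0 k_dvd)).
  by rewrite -mulrz_sumr moebius_quo //; case: eqP; rewrite ?mulr1z ?mulr0z.
rewrite (exchange_big_dep xpredT) //=.
apply: eq_big_seq => d; rewrite -dvdn_divisors // => d_dvd.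
rewrite fE ?dvdn_div // mulrz_suml.
rewrite (perm_big _ (perm_divisors_divn n_gt0 d_dvd)) big_filter.
by apply: eq_bigl => k; rewrite mulnC.
Qed.

Lemma equivalence_partition_saturated
    (T : finType) (R : rel T) (D E : {set T}) :
    E \subset D -> {in D, reflexive R} ->
    {in E, forall x y, R x y -> y \in E} ->
  [set B in equivalence_partition R D | B \subset E] =
  equivalence_partition R E.
Proof.
move=> /subsetP sED R_refl saturated_E.
have eq_class x : x \in E -> [set y in D | R x y] = [set y in E | R x y].
  move=> xE; apply/setP => y; rewrite !inE; apply: andb_id2r => Rxy.
  by have yE := saturated_E x xE y Rxy; rewrite yE sED.
apply/setP => B; rewrite inE.
apply/andP/imsetP => [[/imsetP[x xD ->]]|[x xE ->]].
  move/subsetP/(_ x); rewrite inE xD R_refl // => /(_ isT) xE.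
  by exists x; rewrite ?eq_class.
split; first by rewrite -eq_class // imset_f ?sED.
by apply/subsetP => y; rewrite inE => /andP[].
Qed.

Section Orders.
Variables (T : finType) (f : T -> T).
Hypothesis f_inj : injective f.

Lemma iter_eq_dvdn_order k x : (iter k f x == x) = (order f x %| k)%N.
Proof.
have iter_mulo q : iter (q * order f x) f x = x.
  by elim: q => // q IHq; rewrite mulSn iterD IHq iter_order.
have -> : iter k f x = iter (k %% order f x) f x.
  by rewrite {1}(divn_eq k (order f x)) addnC iterD iter_mulo.
rewrite /dvdn; have := ltn_pmod k (order_gt0 f x).
case: (k %% _)%N => [|i] i_lt; first by rewrite !eqxx.
by apply/negbTE/eqP => /(congr1 (findex f x)); rewrite findex_iter // findex0.
Qed.

Lemma order_fconnect x y : fconnect f x y -> order f y = order f x.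
Proof.
move=> x_y; rewrite /order; apply/esym/eq_card.
exact: same_connect (fconnect_sym f_inj) _ _ x_y.
Qed.

Lemma card_order_moebius (R : pzRingType) (P : pred T) n : (0 < n)%N ->
  #|[set x | P x & order f x == n]|%:R =
  \sum_(d <- divisors n)
    #|[set x | P x & iter (n %/ d) f x == x]|%:R *~ moebius d :> R.
Proof.
move=> n_gt0.
pose fixed_by k : R := #|[set x | P x & iter k f x == x]|%:R.
pose of_order k : R := #|[set x | P x & order f x == k]|%:R.
apply: (@moebius_inversion R fixed_by of_order) => // k k_dvd.
rewrite -natr_sum; congr _%:R.
under [RHS]eq_bigr do rewrite -sum1dep_card big_mkcondr.
rewrite exchange_big -sum1dep_card big_mkcondr; apply: eq_bigr => x _.
rewrite iter_eq_dvdn_order dvdn_divisors ?(dvdn_gt0 n_gt0) //.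
rewrite -big_mkcond sum1_count.
under eq_count do rewrite /= eq_sym.
by rewrite count_uniq_mem ?divisors_uniq //; case: ifP.
Qed.

End Orders.

Section SequencePowers.
Local Open Scope nat_scope.
Variable T : Type.
Implicit Types s u v : seq T.

Definition seq_pow s r : seq T := flatten (nseq r s).

Lemma size_seq_pow s r : size (seq_pow s r) = r * size s.
Proof. by rewrite size_flatten /shape map_nseq sumn_nseq mulnC. Qed.

Lemma seq_pow_tupleP k r (t : k.-tuple T) : size (seq_pow t r) == r * k.
Proof. by rewrite size_seq_pow size_tuple. Qed.

Canonical seq_pow_tuple k r (t : k.-tuple T) := Tuple (seq_pow_tupleP r t).

Lemma seq_powSr s r : seq_pow s r.+1 = seq_pow s r ++ s.
Proof. by rewrite /seq_pow -addn1 nseqD flatten_cat /= cats0. Qed.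

Lemma rot_seq_pow s r : rot (size s) (seq_pow s r) = seq_pow s r.
Proof. by case: r => // r; rewrite {1}/seq_pow /= rot_size_cat -seq_powSr. Qed.

Lemma catC_seq_pow u v r :
  u ++ v = v ++ u -> size v = r * size u -> v = seq_pow u r.
Proof.
elim: r v => [|r IHr] v uvC size_v; first exact: size0nil.
have def_v : v = u ++ drop (size u) v.
  rewrite -{1}(cat_take_drop (size u) v); congr (_ ++ _).
  rewrite -[RHS](take_size_cat v (erefl (size u))) uvC takel_cat //.
  by rewrite size_v leq_pmull.
rewrite def_v; congr (u ++ _); apply: IHr; last first.
  by rewrite size_drop size_v mulSn addKn.
move: uvC; rewrite {1 2}def_v -catA => /(congr1 (drop (size u))).
by rewrite !drop_size_cat.
Qed.

Lemma rot_fixed_seq_pow s k r : size s = r * k -> rot k s = s ->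
  s = seq_pow (take k s) r.
Proof.
case: r => [|r] size_s rot_s; first exact: size0nil.
have k_le : k <= size s by rewrite size_s leq_pmull.
rewrite -{1}(cat_take_drop k s); congr (_ ++ _); apply: catC_seq_pow.
  by rewrite cat_take_drop -[LHS]rot_s.
by rewrite size_drop size_takel // size_s mulSn addKn.
Qed.

End SequencePowers.

Section Rotation.
Local Open Scope nat_scope.
Variables (V : finType) (l : nat).
Implicit Types c : l.-tuple V.

Definition rotation c : l.-tuple V := [tuple of rot 1 c].

Lemma rotation_inj : injective rotation.
Proof. by move=> c c' /(congr1 val) /rot_inj /val_inj. Qed.

Lemma val_iter_rotation i c : i <= l -> iter i rotation c = rot i c :> seq V.
Proof.
elim: i => [|i IHi] i_lt /=; first by rewrite rot0.
by rewrite IHi ?(ltnW i_lt) // -rotS ?size_tuple.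
Qed.

Lemma order_rotation_dvdn c : order rotation c %| l.
Proof.
rewrite -iter_eq_dvdn_order; last exact: rotation_inj.
by rewrite -val_eqE /= val_iter_rotation // rot_oversize ?size_tuple.
Qed.

Lemma rotation_equivE c c' :
  0 < l -> rotation_equiv c c' = fconnect rotation c c'.
Proof.
move=> l_gt0; apply/existsP/idP => [[i /eqP rot_i]|c_c'].
  suff <- : iter i rotation c = c' by apply: fconnect_iter.
  by apply: val_inj; rewrite /= val_iter_rotation // ltnW.
have i_lt : findex rotation c c' < l.
  apply: leq_trans (findex_max c_c') _.
  by apply: dvdn_leq l_gt0 (order_rotation_dvdn c).
exists (Ordinal i_lt).
by rewrite -val_iter_rotation ?(ltnW i_lt) // iter_findex.
Qed.

End Rotation.

Prenex Implicits rotation.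

Section Circuits.
Local Open Scope nat_scope.
Variables (V : finType) (e : rel V).

Lemma cycle_seq_pow s r : 0 < r -> cycle e (seq_pow s r) = cycle e s.
Proof.
case: s r => [|x p] [|r] // _; first by rewrite /seq_pow; elim: r.
have last_pow y q : last y (seq_pow (x :: p) q.+1) = last x p.
  by rewrite seq_powSr last_cat.
rewrite !(cycle_path x) last_pow; elim: r => [|r IHr].
  by rewrite /seq_pow /= cats0.
by rewrite seq_powSr cat_path IHr last_pow andbb.
Qed.

Lemma circuit_seq_pow s r : 0 < r -> circuit e (seq_pow s r) = circuit e s.
Proof.
by move=> r_gt0; rewrite /circuit size_seq_pow muln_gt0 r_gt0 cycle_seq_pow.
Qed.

Lemma circuit_fconnect_rotation l (c c' : l.-tuple V) :
  fconnect rotation c c' -> circuit e c' = circuit e c.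
Proof.
move/iter_findex <-; elim: (findex _ _ _) => // i IHi.
by rewrite -{}IHi /circuit size_rot rot_cycle.
Qed.

Lemma primitive_circuitE l (c : l.-tuple V) :
  primitive_circuit e c = circuit e c && (order rotation c == l).
Proof.
have [circuit_c|/negbTE not_circuit] := boolP (circuit e c); last first.
  by rewrite /primitive_circuit not_circuit.
have l_gt0 : 0 < l by case/andP: circuit_c; rewrite size_tuple.
set t := order _ c; have t_dvd : t %| l by apply: order_rotation_dvdn.
have t_le := dvdn_leq l_gt0 t_dvd; case/dvdnP: t_dvd => r def_l.
have r_gt0 : 0 < r by case: r def_l l_gt0 => // ->.
apply/primitive_circuitP/eqP => [[_ no_root]|t_eq_l].
  apply/eqP; rewrite eqn_leq t_le leqNgt; apply/negP=> t_lt.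
  apply: no_root; exists (take t c), r.
  have def_c : c = seq_pow (take t c) r :> seq V.
    apply: rot_fixed_seq_pow; first by rewrite size_tuple.
    rewrite -val_iter_rotation ?(ltnW t_lt) // iter_order //.
    exact: rotation_inj.
  split; [|by rewrite size_takel // size_tuple ltnW|exact: def_c].
  by rewrite -(circuit_seq_pow _ r_gt0) -def_c.
split=> // -[b [q [/andP[b_gt0 _] b_lt def_c]]].
suff : t %| size b by move/(dvdn_leq b_gt0); rewrite t_eq_l leqNgt b_lt.
rewrite -iter_eq_dvdn_order; last exact: rotation_inj.
by rewrite -val_eqE /= val_iter_rotation ?(ltnW b_lt) // def_c rot_seq_pow.
Qed.

Lemma card_rotation_fixed_circuits k r : 0 < r ->
  #|[set c : (r * k).-tuple V | circuit e c & iter k rotation c == c]| =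
  #|[set b : k.-tuple V | circuit e b]|.
Proof.
move=> r_gt0; have k_le : k <= r * k by rewrite leq_pmull.
pose pow (b : k.-tuple V) : (r * k).-tuple V := [tuple of seq_pow b r].
have pow_inj : injective pow.
  move=> b b' /(congr1 (take k \o val)) /=; case: r r_gt0 {k_le pow} => // r _.
  by rewrite /seq_pow /= !take_size_cat ?size_tuple // => /val_inj.
rewrite -(card_imset _ pow_inj); apply: eq_card => c; rewrite inE.
apply/andP/imsetP => [[circuit_c /eqP fix_c]|[b + ->]]; last first.
  rewrite inE circuit_seq_pow // => ->; split=> //; apply/eqP/val_inj.
  by rewrite /= val_iter_rotation //= -{1}(size_tuple b) rot_seq_pow.
have size_b : size (take k c) == k by rewrite size_takel // size_tuple.
have def_c : c = seq_pow (Tuple size_b) r :> seq V.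
  apply: rot_fixed_seq_pow; first by rewrite size_tuple.
  by rewrite -val_iter_rotation // fix_c.
exists (Tuple size_b); last exact: val_inj.
by rewrite inE -(circuit_seq_pow _ r_gt0) -def_c.
Qed.

Lemma card_primitive_circuits (R : pzRingType) l : 0 < l ->
  (#|[set c : l.-tuple V | primitive_circuit e c]|%:R =
   \sum_(d <- divisors l)
     #|[set b : (l %/ d).-tuple V | circuit e b]|%:R *~ moebius d :> R)%R.
Proof.
move=> l_gt0; under eq_finset do rewrite primitive_circuitE.
rewrite card_order_moebius //; last exact: rotation_inj.
apply: eq_big_seq => d; rewrite -dvdn_divisors // => d_dvd.
congr (_%:R *~ _)%R; have d_gt0 := dvdn_gt0 l_gt0 d_dvd.
move: (l %/ d) (divnK d_dvd) => k def_l; rewrite -{l l_gt0 d_dvd}def_l mulnC.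
exact: card_rotation_fixed_circuits.
Qed.

Lemma primitive_circuit_fconnect_rotation l (c c' : l.-tuple V) :
  fconnect rotation c c' -> primitive_circuit e c' = primitive_circuit e c.
Proof.
move=> c_c'; rewrite !primitive_circuitE (circuit_fconnect_rotation c_c').
by rewrite (order_fconnect (@rotation_inj _ _) c_c').
Qed.

Lemma primitive_periodic_orbitsE l : 0 < l ->
  primitive_periodic_orbits e l =
  equivalence_partition (@rotation_equiv V l) [set c | primitive_circuit e c].
Proof.
move=> l_gt0; pose D := [set c : l.-tuple V | circuit e c].
rewrite -(@equivalence_partition_saturated _ _ D).
- apply/setP=> O; rewrite !inE; congr (_ && _).
  by apply/forall_inP/subsetP => prim_O c /prim_O; rewrite inE.
- by apply/subsetP => c; rewrite !inE => /andP[].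
- by move=> c _; rewrite rotation_equivE //= connect0.
- move=> c + c'; rewrite !inE rotation_equivE // => prim_c c_c'.
  by rewrite (primitive_circuit_fconnect_rotation c_c').
Qed.

Lemma card_primitive_periodic_orbits l : 0 < l ->
  #|primitive_periodic_orbits e l| * l =
  #|[set c : l.-tuple V | primitive_circuit e c]|.
Proof.
move=> l_gt0; rewrite primitive_periodic_orbitsE //.
apply/esym/card_uniform_partition.
  move=> O /imsetP[c]; rewrite inE => primitive_c ->.
  move: (primitive_c); rewrite primitive_circuitE => /andP[_ /eqP order_c].
  rewrite -[RHS]order_c; apply: eq_card => c'.
  rewrite !inE rotation_equivE // andb_idl // => c_c'.
  by rewrite (primitive_circuit_fconnect_rotation c_c').
apply: equivalence_partitionP; apply: sub_in3 (@rotation_equivP V e l) => c.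
by rewrite !inE => /andP[].
Qed.

End Circuits.

Lemma big_tuple_cons (R : Type) (idx : R) (op : Monoid.com_law idx)
    (T : finType) k (F : k.+1.-tuple T -> R) :
  \big[op/idx]_t F t =
  \big[op/idx]_x \big[op/idx]_(s : k.-tuple T) F [tuple of x :: s].
Proof.
rewrite pair_big /=.
rewrite (reindex (fun p : T * k.-tuple T => [tuple of p.1 :: p.2])) //.
exists (fun t : k.+1.-tuple T => (thead t, [tuple of behead t])).
  by move=> [x s] _ /=; congr pair; apply/val_inj.
by move=> t _; rewrite -tuple_eta.
Qed.

Section Adjacency.
Variables (n : nat) (e : rel 'I_n).

Definition adjacency_mx : 'M[nat]_n := \matrix_(v, w) (e v w : nat).

Lemma adjacency_mxXE k v w :
  (adjacency_mx ^+ k) v w =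
  #|[set s : k.-tuple 'I_n | path e v s & last v s == w]|.
Proof.
rewrite -sum1dep_card big_mkcond; elim: k v => [|k IHk] v.
  rewrite expr0 mxE (big_pred1 [tuple]) => [|s]; last exact/esym/eqP/tuple0.
  by rewrite /=; case: eqP.
rewrite exprS mxE big_tuple_cons; apply: eq_bigr => u _.
rewrite mxE IHk big_distrr; apply: eq_bigr => s _ /=.
by case: (e v u); rewrite ?mul1r ?mul0r.
Qed.

Lemma card_circuits_mxtrace k : (0 < k)%N ->
  #|[set c : k.-tuple 'I_n | circuit e c]| = \tr (adjacency_mx ^+ k).
Proof.
case: k => // k _; rewrite /mxtrace.
under [RHS]eq_bigr do rewrite adjacency_mxXE -sum1dep_card big_mkcond.
rewrite exchange_big -sum1dep_card big_mkcond; apply: eq_bigr => c _.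
have last_c v : last v c = last (thead c) c by case/tupleP: c.
rewrite /circuit size_tuple (cycle_path (thead c)) /=.
rewrite (bigD1 (last (thead c) c)) //= big1 => [|v /negPf v_neq].
  by rewrite (last_c (last _ _)) eqxx andbT addr0.
by rewrite (last_c v) eq_sym v_neq andbF.
Qed.

End Adjacency.

Section ShiftMatrix.
Variable n : nat.

Definition shift_mx a : 'M[nat]_n :=
  \matrix_(v, w) ((w : nat) == (v + a) %% n : nat)%N.

Lemma shift_mx0 : shift_mx 0 = 1.
Proof.
by apply/matrixP => v w; rewrite !mxE addn0 modn_small // natn eq_sym.
Qed.

Lemma shift_mxD a b : shift_mx (a + b) = shift_mx a * shift_mx b.
Proof.
apply/matrixP => v w; rewrite !mxE.
have n_gt0 : (0 < n)%N := leq_ltn_trans (leq0n v) (ltn_ord v).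
rewrite (bigD1 (Ordinal (ltn_pmod (v + a) n_gt0))) //= big1 => [|u].
  by rewrite !mxE eqxx mul1r modnDml addnA addr0.
by rewrite !mxE -val_eqE /= => /negPf ->; rewrite mul0r.
Qed.

Lemma shift_mxX a k : shift_mx a ^+ k = shift_mx (a * k).
Proof.
elim: k => [|k IHk]; first by rewrite muln0 shift_mx0.
by rewrite exprS IHk -shift_mxD mulnS.
Qed.

Lemma mxtrace_shift a : \tr (shift_mx a) = (n * (n %| a))%N.
Proof.
rewrite /mxtrace (eq_bigr (fun=> (n %| a : nat)%N)) => [|v _].
  by rewrite sum_nat_const card_ord.
rewrite mxE -{1}(modn_small (ltn_ord v)) -{1}[val v]addn0.
by rewrite eqn_modDl mod0n eq_sym.
Qed.

Lemma adjacency_circulant a d : (0 < d < n)%N ->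
  adjacency_mx (@circulant_bond n a d) = shift_mx a + shift_mx (a + d).
Proof.
case/andP=> d_gt0 d_lt; apply/matrixP => v w.
rewrite !mxE /circulant_bond addnA.
case: eqP => [->|_]; last by rewrite add0r.
have /negPf -> : ((v + a) %% n != (v + a + d) %% n)%N.
  by rewrite -{1}[(v + a)%N]addn0 eqn_modDl mod0n modn_small // eq_sym -lt0n.
by rewrite addr0.
Qed.

Lemma card_circulant_circuits a d k : (0 < d < n)%N -> (0 < k)%N ->
  (#|[set c : k.-tuple 'I_n | circuit (@circulant_bond n a d) c]| =
   n * \sum_(j < k.+1) 'C(k, j) * (n %| a * k + d * j))%N.
Proof.
move=> d_lt k_gt0; rewrite card_circuits_mxtrace // adjacency_circulant //.
rewrite exprDn_comm; last by rewrite /GRing.comm -!shift_mxD addnC.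
rewrite raddf_sum big_distrr; apply: eq_bigr => j _.
have j_le : (j <= k)%N by rewrite -ltnS.
have -> : (a * k + d * j = a * (k - j) + (a + d) * j)%N by nia.
rewrite raddfMn !shift_mxX -shift_mxD /= mxtrace_shift -mulr_natr natn.
by rewrite [RHS]mulnCA [LHS]mulnC.
Qed.

End ShiftMatrix.

Section Floors.
Variable R : archiRealFieldType.
Implicit Types x : R.

Lemma absz_ceil_le_nat x m : 0 <= x -> (`|Num.ceil x| <= m)%N = (x <= m%:R).
Proof.
move=> x_ge0; rewrite -lez_nat gez0_abs; last first.
  by rewrite ceil_ge0 (lt_le_trans (ltrN10 _)).
by rewrite ceil_le_int -pmulrn.
Qed.

Lemma absz_floor_ge_nat x m : 0 <= x -> (m <= `|Num.floor x|)%N = (m%:R <= x).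
Proof. by move=> x_ge0; rewrite -truncn_ge_nat // truncn_floor x_ge0. Qed.

End Floors.

Lemma binomial_rat_natl k x :
  binomial_rat k%:R x = (\sum_(j < k.+1) 'C(k, j) * (x == j%:R))%N.
Proof.
rewrite /binomial_rat natr_nat natrK /=.
case: ifPn => [/natrP[i ->]|x_notin]; last first.
  rewrite big1 // => j _.
  by case: eqP x_notin => [->|]; rewrite ?natr_nat ?muln0.
rewrite natrK; under eq_bigr do rewrite eqr_nat.
have [i_le|i_gt] := leqP i k; last first.
  rewrite bin_small // big1 // => j _.
  by rewrite gtn_eqF ?muln0 // (leq_trans (ltn_ord j)).
rewrite (bigD1 (Ordinal (i_le : i < k.+1)%N)) //= big1 => [|j].
  by rewrite eqxx muln1 addn0.
by rewrite -val_eqE eq_sym /= => /negPf ->; rewrite muln0.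
Qed.

Lemma sum_eq_mul_dvdn p q n w y : (0 < n)%N -> (0 < w)%N ->
    (forall m, (m * n = w * y)%N -> (p <= m < q)%N) ->
  (\sum_(p <= m < q | w %| m) (m * n == w * y) = (n %| y))%N.
Proof.
move=> n_gt0 w_gt0 in_range.
have [/dvdnP[z def_y]|n_ndvd] := boolP (n %| y)%N; last first.
  rewrite big1 // => m /dvdnP[z ->]; apply/eqP; rewrite eqb0.
  apply: contra n_ndvd; rewrite mulnAC [(w * y)%N]mulnC eqn_pmul2r //.
  by move=> /eqP <-; rewrite dvdn_mull.
have eq_zw m : (m * n == w * y)%N = (m == z * w)%N.
  by rewrite def_y mulnA eqn_pmul2r // [(w * z)%N]mulnC.
under eq_bigr do rewrite eq_zw.
rewrite -big_filter.
rewrite (bigD1_seq (z * w)%N) /= ?filter_uniq ?iota_uniq //; last first.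
  rewrite mem_filter dvdn_mull // mem_index_iota in_range //.
  by apply/eqP; rewrite eq_zw.
by rewrite eqxx big1 // => m /negPf ->.
Qed.

Lemma sum_binomial_rat a d n l w :
    (0 < d)%N -> (0 < n)%N -> (0 < w)%N -> (w %| l)%N ->
  (\sum_(`|Num.ceil ((a * l)%N%:R / n%:R : rat)|%N <= m
          < (`|Num.floor (((d + a) * l)%N%:R / n%:R : rat)|%N).+1 | w %| m)
     binomial_rat (l%:R / w%:R) ((m%:R * n%:R - a%:R * l%:R) / (w%:R * d%:R)) =
   \sum_(j < (l %/ w).+1) 'C(l %/ w, j) * (n %| a * (l %/ w) + d * j))%N.
Proof.
move=> d_gt0 n_gt0 w_gt0 /dvdnP[k ->]; rewrite mulnK //.
have wd_neq0 : w%:R * d%:R != 0 :> rat by rewrite mulf_neq0 // pnatr_eq0 -lt0n.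
rewrite (natrM _ k w) mulfK ?pnatr_eq0 -?lt0n //.
under eq_bigr do rewrite binomial_rat_natl.
rewrite exchange_big; apply: eq_bigr => j _; rewrite -big_distrr /=; congr muln.
have lower_index_eq m :
    ((m%:R * n%:R - a%:R * (k%:R * w%:R)) / (w%:R * d%:R) == j%:R :> rat) =
    (m * n == w * (a * k + d * j))%N.
  rewrite -(inj_eq (mulIf wd_neq0)) divfK // subr_eq -!natrM -natrD eqr_nat.
  by congr (_ == _); lia.
under eq_bigr do rewrite lower_index_eq.
apply: sum_eq_mul_dvdn => // m mn_eq.
rewrite ltnS absz_ceil_le_nat ?absz_floor_ge_nat ?divr_ge0 //.
rewrite ler_pdivrMr ?ler_pdivlMr ?ltr0n // -!natrM !ler_nat mn_eq.
rewrite [(w * _)%N]mulnC !mulnA !leq_pmul2r // leq_addr addnC mulnDl leq_add2r.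
by rewrite leq_mul2l -ltnS ltn_ord orbT.
Qed.

Theorem theorem1 (a1 d n l : nat) (a1_gt0 : (0 < a1)%N) (d_gt0 : (0 < d)%N)
    (n_gt : (a1 + d < n)%N) (l_gt0 : (0 < l)%N) :
  #|primitive_periodic_orbits (@circulant_bond n a1 d) l|%:R =
    n%:R / l%:R *
    (\sum_(`|Num.ceil ((a1 * l)%N%:R / n%:R : rat)|%N <= m
            < (`|Num.floor (((d + a1) * l)%N%:R / n%:R : rat)|%N).+1)
      \sum_(1 <= w < l.+1 | (w %| m)%N && (w %| l)%N)
        (moebius w)%:~R *
        (binomial_rat (l%:R / w%:R)
           ((m%:R * n%:R - a1%:R * l%:R) / (w%:R * d%:R)))%:R) :> rat.
Proof.
have n_gt0 : (0 < n)%N by lia.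
have d_bounds : (0 < d < n)%N by lia.
have l_neq0 : l%:R != 0 :> rat by rewrite pnatr_eq0 -lt0n.
apply: (mulIf l_neq0); rewrite -[LHS]natrM card_primitive_periodic_orbits //.
rewrite card_primitive_circuits // mulrAC divfK //.
rewrite (exchange_big_dep (fun w => w %| l)%N) /=; last by move=> m w _ /andP[].
rewrite -[in RHS]big_filter -(perm_big _ (perm_divisors_filter_iota l_gt0)).
rewrite mulr_sumr; apply: eq_big_seq => w; rewrite -dvdn_divisors // => w_dvd.
have w_gt0 := dvdn_gt0 l_gt0 w_dvd.
have quo_gt0 := dvdn_gt0 l_gt0 (dvdn_div w_dvd).
rewrite card_circulant_circuits // -sum_binomial_rat // natrM natr_sum.
rewrite -mulrzr -mulrA mulr_suml; congr (_ * _).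
by apply: eq_big => [m|m _]; rewrite ?w_dvd ?andbT // mulrC.
Qed.
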